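(* Let $G$ be a simple graph of order $n$ with average degree $d$, let $0=\sigma_0\le\sigma_1\le\cdots\le\sigma_{n-1}$ be its Laplacian eigenvalues, and let $\theta\ge0$ be a real number such that $|d-\sigma_i|\le\theta$ for all $i=1,\dots,n-1$. Then $$\pi(G)\ge\frac{2n}{d+\theta}.$$
   Context: The Laplacian matrix of $G$ is $L(G)=D(G)-A(G)$ (degree diagonal matrix minus adjacency matrix); its eigenvalues are the Laplacian eigenvalues, ordered increasingly. The average degree is $d=\frac1n\sum_v d_v$. A routing $R$ of $G$ is a set of $n(n-1)$ paths in $G$, one specified path from $u$ to $v$ for every ordered pair $(u,v)$ of distinct vertices. For an edge $e$, $\pi(G,R,e)$ is the number of paths of $R$ going through $e$. The edge forwarding index is $\pi(G)=\min_R\max_{e\in E(G)}\pi(G,R,e)$ (taken to be $+\infty$ if no routing exists). *)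

(* Defs.v *)
From mathcomp Require Import all_boot all_order all_algebra.
From mathcomp Require Import boolp classical_sets reals ereal.

Set Implicit Arguments.
Unset Strict Implicit.
Unset Printing Implicit Defensive.

Import Order.TTheory GRing.Theory Num.Theory.

Local Open Scope ring_scope.

Record sgraph (T : finType) := SGraph {
  adj :> rel T;
  adj_sym : symmetric adj;
  adj_irrefl : irreflexive adj }.

Section Graph.
Variables (T : finType) (G : sgraph T).

Definition edges : {set {set T}} :=
  [set [set p.1; p.2] | p in [pred p : T * T | adj G p.1 p.2]].

Definition degree (x : T) : nat := #|[set y | adj G x y]|.

(* The sequence x :: p lists the vertices of a path; as u :: p has no
   repetition, paths are self-avoiding. *)
Definition path_edges (x : T) (p : seq T) : seq {set T} :=
  pairmap (fun a b => [set a; b]) x p.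

Definition is_path (x y : T) (p : seq T) : bool :=
  [&& path (adj G) x p, last x p == y & uniq (x :: p)].

(* The chosen path from x to y is x :: r x y; the values r x x are
   irrelevant and are not counted below. *)
Definition is_routing (r : T -> T -> seq T) : Prop :=
  forall x y, x != y -> is_path x y (r x y).

Definition edge_load (r : T -> T -> seq T) (E : {set T}) : nat :=
  #|[set p : T * T | (p.1 != p.2) && (E \in path_edges p.1 (r p.1 p.2))]|.

Definition max_load (r : T -> T -> seq T) : nat :=
  (\max_(E in edges) edge_load r E)%N.

End Graph.

Section RealGraph.
Variables (R : realType) (T : finType) (G : sgraph T).

(* The infimum is over a set of naturals, hence a minimum as soon as a routing
   exists; it is +oo when there is none. *)
Definition edge_forwarding_index : \bar R :=
  ereal_inf [set ((max_load G r)%:R)%:E | r in [set r | is_routing G r]]%classic.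

Definition average_degree : R := (\sum_(x : T) (degree G x)%:R) / #|T|%:R.

Definition adjacency_mx : 'M[R]_#|T| :=
  \matrix_(i, j) (adj G (enum_val i) (enum_val j))%:R.

Definition degree_mx : 'M[R]_#|T| :=
  diag_mx (\row_i (degree G (enum_val i))%:R).

Definition laplacian_mx : 'M[R]_#|T| := degree_mx - adjacency_mx.

End RealGraph.

(* s lists all the eigenvalues of A with multiplicity, in increasing order. *)
Definition ordered_eigenvalues (R : realType) (n : nat) (A : 'M[R]_n)
    (s : 'I_n -> R) : Prop :=
  {homo s : i j / (i <= j)%N >-> i <= j} /\
  char_poly A = \prod_(i < n) ('X - (s i)%:P).

(* Main.v *)
Require Import Defs.
From mathcomp Require Import all_boot all_order all_algebra.
From mathcomp Require Import reals ereal.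

(** Only the trace of the Laplacian is needed. Since 0 is an eigenvalue,
    [n * d = \sum_i sigma i <= (n - 1) * (d + theta)]. On the other hand a vertex
    [v] of minimal degree has degree at most [d], and each of the [2 * (n - 1)]
    paths of a routing with [v] as an end uses an edge at [v], so that
    [2 * (n - 1) <= max_load * d]. Combining both gives the bound. *)

Set Implicit Arguments.
Unset Strict Implicit.
Unset Printing Implicit Defensive.

Import Order.TTheory GRing.Theory Num.Theory.

Local Open Scope ring_scope.

Lemma path_edges_head (T : finType) (G : sgraph T) (x y : T) (p : seq T) :
  x != y -> is_path G x y p ->
  exists2 a, adj G x a & [set x; a] \in path_edges x p.
Proof.
move=> xy /and3P[]; case: p => [|a p] /=.
  by move=> _ /eqP exy; rewrite exy eqxx in xy.
by move=> /andP[xa _] _ _; exists a => //; rewrite mem_head.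
Qed.

Lemma path_edges_last (T : finType) (G : sgraph T) (x y : T) (p : seq T) :
  x != y -> is_path G x y p ->
  exists2 a, adj G y a & [set y; a] \in path_edges x p.
Proof.
move=> xy /and3P[]; case/lastP: p => [|p z].
  by move=> _ /eqP exy; rewrite /= in exy; rewrite exy eqxx in xy.
rewrite last_rcons rcons_path => /andP[_ az] /eqP <- _.
(* The neighbour is the penultimate vertex of the path, which is [x] itself when [p] is empty. *)
exists (last x p); first by rewrite adj_sym.
by rewrite /path_edges -cats1 pairmap_cat mem_cat setUC mem_head orbT.
Qed.

Lemma leq_card_bigcup (I T : finType) (P : pred I) (F : I -> {set T}) :
  (#|\bigcup_(i | P i) F i| <= \sum_(i | P i) #|F i|)%N.
Proof.
elim/big_ind2: _ => [|m A n B lAm lBn|//]; first by rewrite cards0.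
exact: leq_trans (leq_card_setU A B).1 (leq_add lAm lBn).
Qed.

(** A union bound: the ordered pairs having [v] as exactly one end are covered by the sets [L w],
    one for each neighbour [w] of [v], and each has at most [max_load G r] elements. *)
Lemma max_load_degree (T : finType) (G : sgraph T) (r : T -> T -> seq T)
    (v : T) : is_routing G r ->
  (2 * #|T|.-1 <= max_load G r * degree G v)%N.
Proof.
move=> rP; set S := setX [set v] [set~ v] :|: setX [set~ v] [set v].
pose L w := [set p : T * T |
  (p.1 != p.2) && ([set v; w] \in path_edges p.1 (r p.1 p.2))].
have <- : #|S| = (2 * #|T|.-1)%N.
  rewrite cardsU !cardsX cards1 cardsC1 mul1n muln1.
  (* The two halves of [S] are disjoint, as the first coordinate is [v] in one and differs from [v]
     in the other. *)
  rewrite (_ : _ :&: _ = finset.set0) ?cards0 ?subn0 ?mul2n ?addnn //.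
  by apply/setP=> -[a b]; rewrite !inE /=; case: (a == v); rewrite ?andbF.
have sSL : S \subset \bigcup_(w | adj G v w) L w.
  apply/subsetP=> -[a b]; rewrite !inE /= => /orP[] /andP[].
  - move=> /eqP -> bv; have vb : v != b by rewrite eq_sym.
    have [w vw wE] := path_edges_head vb (rP _ _ vb).
    by apply/bigcupP; exists w => //; rewrite inE /= vb.
  - move=> av /eqP ->; have [w vw wE] := path_edges_last av (rP _ _ av).
    by apply/bigcupP; exists w => //; rewrite inE /= av.
apply: leq_trans (subset_leq_card sSL) _.
apply: leq_trans (leq_card_bigcup _ _) _.
have -> : degree G v = #|[pred w | adj G v w]| by rewrite /degree cardsE.
rewrite mulnC -sum_nat_const; apply: leq_sum => w vw.
(* The cardinal of [L w] is by definition the load of the edge between [v] and [w]. *)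
apply: (leq_bigmax_cond (F := edge_load r)).
by apply/imsetP; exists (v, w).
Qed.

Section Laplacian.
Variables (R : realType) (T : finType) (G : sgraph T).

Lemma mxtrace_laplacian :
  \tr (laplacian_mx R G) = \sum_(x : T) (degree G x)%:R.
Proof.
rewrite [RHS]big_enum_val; apply: eq_bigr => i _.
by rewrite !mxE adj_irrefl subr0 eqxx.
Qed.

(** The all-ones row vector is a left eigenvector: by symmetry of [adj], each column of the
    adjacency matrix sums to the degree. *)
Lemma laplacian_eigenvalue0 :
  (0 < #|T|)%N -> eigenvalue (laplacian_mx R G) 0.
Proof.
move=> n_gt0; apply/eigenvalueP; exists (const_mx 1); last first.
  apply/eqP => /matrixP/(_ 0 (Ordinal n_gt0)).
  by rewrite !mxE => /eqP; rewrite oner_eq0.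
rewrite scale0r mulmxBr; apply/eqP; rewrite subr_eq0; apply/eqP/rowP => j.
rewrite mul_mx_diag !mxE mul1r.
under eq_bigr => i _ do rewrite !mxE mul1r adj_sym.
rewrite -(big_enum_val (fun x => (adj G (enum_val j) x)%:R)) -natr_sum.
by rewrite -big_mkcond sum1_card /degree cardsE.
Qed.

End Laplacian.

(** Both sides are, up to sign, the coefficient of degree [n.-1] of the characteristic
    polynomial. *)
Lemma sum_ordered_eigenvalues (R : realType) (n : nat) (A : 'M[R]_n)
    (s : 'I_n -> R) :
  (0 < n)%N -> ordered_eigenvalues A s -> \sum_i s i = \tr A.
Proof.
move=> n_gt0 [_ chA]; apply: oppr_inj; rewrite -char_poly_trace // chA.
pose t := [seq s i | i <- index_enum 'I_n].
have st : size t = n by rewrite -sum1_size big_map sum1_card card_ord.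
rewrite -(big_map s xpredT (fun x => 'X - x%:P)) -(big_map s xpredT id) -/t.
by rewrite -[X in _`_X.-1]st coefPn_prod_XsubC // st -lt0n.
Qed.

Lemma ordered_eigenvalues_head_le (R : realType) (n : nat) (A : 'M[R]_n)
    (s : 'I_n -> R) (a : R) (i : 'I_n) :
  ordered_eigenvalues A s -> eigenvalue A a -> i = 0%N :> nat -> s i <= a.
Proof.
move=> [s_mono chA]; rewrite eigenvalue_root_char chA.
rewrite -(big_map s xpredT (fun x => 'X - x%:P)) root_prod_XsubC.
by move=> /mapP[j _ ->] i0; apply: s_mono; rewrite i0.
Qed.

Theorem theorem4p4 (R : realType) (T : finType) (G : sgraph T)
    (sigma : 'I_#|T| -> R) (theta : R)
    (order_ge2 : (2 <= #|T|)%N)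
    (sigma_eig : ordered_eigenvalues (laplacian_mx R G) sigma)
    (theta_ge0 : 0 <= theta)
    (theta_bound : forall i : 'I_#|T|, (1 <= i)%N ->
       `|average_degree R G - sigma i| <= theta) :
  (((2 * #|T|%:R) / (average_degree R G + theta))%:E
     <= edge_forwarding_index R G)%E.
Proof.
(* It suffices to bound the maximal load of each routing; this also covers an empty set of routings,
   whose infimum is +oo. *)
apply: le_ereal_inf_tmp => _ [r rP <-]; rewrite lee_fin.
set n := #|T| in sigma sigma_eig theta_bound order_ge2 *.
set d := average_degree R G in theta_bound *.
have n_gt0 : (0 < n)%N by exact: ltnW.
have nR_gt0 : 0 < n%:R :> R by rewrite ltr0n.
have sum_deg : \sum_(x : T) (degree G x)%:R = d * n%:R.
  by rewrite /d /average_degree divfK // gt_eqF.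
have d_ge0 : 0 <= d by apply: divr_ge0 => //; apply: sumr_ge0.
have trace_le : d * n%:R <= n.-1%:R * (d + theta).
  rewrite -sum_deg -mxtrace_laplacian -(sum_ordered_eigenvalues n_gt0 sigma_eig).
  pose i0 := Ordinal n_gt0.
  (* The term of index 0 is at most the eigenvalue 0; each of the [n.-1] others is at most
     [d + theta]. *)
  rewrite (bigD1 i0) //= -[leRHS]add0r lerD //.
    apply: ordered_eigenvalues_head_le sigma_eig _ _ => //.
    exact: laplacian_eigenvalue0.
  have -> : n.-1%:R * (d + theta) = \sum_(i < n | i != i0) (d + theta).
    by rewrite sumr_const cardC1 card_ord mulr_natl.
  apply: ler_sum => i; rewrite -val_eqE -lt0n => /theta_bound.
  by rewrite distrC ler_norml lerBlDl => /andP[_].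
have [x0 _] : exists x : T, x \in T by apply/card_gt0P.
have [v _ v_min] := arg_minnP (degree G) (isT : xpredT x0).
have deg_le : (degree G v)%:R <= d.
  rewrite -(ler_pM2r nR_gt0) -sum_deg mulr_natr -sumr_const.
  by apply: ler_sum => x _; rewrite ler_nat v_min.
have load_le : 2 * n.-1%:R <= (max_load G r)%:R * d :> R.
  apply: le_trans (ler_wpM2l (ler0n _ _) deg_le).
  by rewrite -!natrM ler_nat max_load_degree.
(* If [d + theta] vanishes, the quotient is 0 by convention and the bound is trivial. *)
have [dt0|dt_neq0] := eqVneq (d + theta) 0; first by rewrite dt0 invr0 mulr0.
have dt_gt0 : 0 < d + theta by rewrite lt_def dt_neq0 addr_ge0.
have n1_gt0 : 0 < n.-1%:R :> R by rewrite ltr0n -subn1 subn_gt0.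
(* With M the maximal load, after multiplication by n - 1 > 0 the chain is 2(n - 1)n <= M d n <= M
   (n - 1)(d + theta). *)
rewrite ler_pdivrMr // -(ler_pM2l n1_gt0) mulrCA mulrA.
apply: le_trans (ler_wpM2r (ltW nR_gt0) load_le) _.
rewrite -mulrA [leRHS]mulrCA.
exact: ler_wpM2l.
Qed.
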